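(* Let $(G,\epsilon)$ be an $n$-vertex signed graph with $m$ edges, and let $k=p^r$ be a power of a prime. If $\chi(G,\epsilon)\le k$ and $m\le(k-1)n$, then $$P((G,\epsilon),k)\ge k^{\,n-\frac{m}{k-1}}.$$
   Context: A signed graph $(G,\epsilon)$ is a graph $G$ with a map $\epsilon:E(G)\to\{-1,1\}$. The color sets are $M_{2t+1}=\{0,\pm1,\dots,\pm t\}$ and $M_{2t}=\{\pm1,\dots,\pm t\}$. A $k$-coloring of $(G,\epsilon)$ is a map $\kappa:V(G)\to M_k$ such that $\kappa(v)\ne\epsilon(e)\kappa(u)$ for every edge $e=uv$. $P((G,\epsilon),k)$ is the number of $k$-colorings of $(G,\epsilon)$, and $\chi(G,\epsilon)$ is the least $k$ such that $(G,\epsilon)$ has a $k$-coloring. *)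

(* Defs.v *)
From HB Require Import structures.
From mathcomp Require Import all_boot all_order all_algebra.
Set Implicit Arguments.
Unset Strict Implicit.
Unset Printing Implicit Defensive.
Import Order.TTheory GRing.Theory Num.Theory.
Local Open Scope ring_scope.

(* Finite loopless undirected graphs; parallel edges are allowed, possibly with
   different signs. Simple graphs are the case where [ends] is injective. *)
Record graph := Graph {
  vertex : finType;
  edge : finType;
  ends : edge -> {set vertex};
  card_ends : forall e, #|ends e| = 2%N
}.

Record signed_graph := SignedGraph {
  base :> graph;
  sgn : edge base -> int;
  sgnP : forall e, sgn e \in [:: -1; 1]
}.

(* M_k: plus or minus 1, ..., k./2, together with 0 exactly when k is odd. *)
Definition M (k : nat) : seq int :=
  (if odd k then [:: 0] else [::])
  ++ [seq i%:Z | i <- iota 1 k./2] ++ [seq - i%:Z | i <- iota 1 k./2].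

Lemma mem_M (k : nat) (x : int) :
  (x \in M k) = (`|x| <= k./2)%N && (odd k || (x != 0)).
Proof.
have memP y : (y \in iota 1 k./2) = (0 < y <= k./2)%N.
  by rewrite mem_iota add1n ltnS.
rewrite /M !mem_cat; apply/idP/idP => [/or3P[]|].
- by case: (odd k) => //=; rewrite inE => /eqP->; rewrite absz0.
- case/mapP=> i; rewrite memP => /andP[i0 ik] ->.
  by rewrite absz_nat ik /=; case: i i0 {ik} => // i _; rewrite orbT.
- case/mapP=> i; rewrite memP => /andP[i0 ik] ->.
  by rewrite abszN absz_nat ik /= oppr_eq0; case: i i0 {ik} => // i _; rewrite orbT.
case/andP=> xk; have [->|x0 _] := eqVneq x 0; first by rewrite orbF => ->.
have ax : (`|x|%N \in iota 1 k./2) by rewrite memP absz_gt0 x0.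
apply/or3P; case: (ltrP x 0) => sx.
- by apply: Or33; apply/mapP; exists `|x|%N => //; rewrite ltz0_abs // opprK.
- by apply: Or32; apply/mapP; exists `|x|%N => //; rewrite gez0_abs.
Qed.

Lemma uniq_M (k : nat) : uniq (M k).
Proof.
rewrite /M !cat_uniq !map_inj_uniq ?iota_uniq //=; last 2 first.
- by move=> i j /oppr_inj [].
- by move=> i j [].
rewrite andbT; apply/and3P; split; first by case: (odd k).
- apply/hasPn => x; rewrite mem_cat => /orP[] /mapP[i];
    rewrite mem_iota => /andP[i0 _] ->; case: (odd k) => //=;
    rewrite inE ?oppr_eq0; by case: i i0.
- apply/hasPn => x /mapP[i]; rewrite mem_iota => /andP[i0 _] ->.
  by apply/mapP => -[j _]; case: i i0.
Qed.

Lemma size_M (k : nat) : size (M k) = k.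
Proof.
rewrite /M !size_cat !size_map !size_iota addnn -[RHS]odd_double_half.
by case: (odd k).
Qed.

Definition color (k : nat) := seq_sub (M k).

Definition is_coloring (G : signed_graph) (k : nat)
    (f : {ffun vertex G -> color k}) : bool :=
  [forall e : edge G, forall u : vertex G, forall v : vertex G,
    (ends e == [set u; v]) ==> (val (f v) != sgn e * val (f u))].

Definition num_colorings (G : signed_graph) (k : nat) : nat :=
  #|[set f : {ffun vertex G -> color k} | is_coloring f]|.

Definition colorable (G : signed_graph) (k : nat) : bool :=
  [exists f : {ffun vertex G -> color k}, is_coloring f].

Lemma colorable_exists (G : signed_graph) : exists k, colorable G k.
Proof.
exists (#|vertex G|).*2.
have inM (v : vertex G) : (enum_rank v).+1%:Z \in M (#|vertex G|).*2.
  by rewrite mem_M absz_nat doubleK ltn_ord orbT.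
apply/existsP; exists [ffun v => SeqSub (inM v)].
apply/forallP => e; apply/forallP => u; apply/forallP => v; apply/implyP => /eqP Ee.
have uv : u != v by have := card_ends e; rewrite Ee cards2; case: (u != v).
rewrite !ffunE /=; have := sgnP e; rewrite !inE => /orP[]/eqP->.
- by rewrite mulN1r.
- rewrite mul1r; apply: contra uv => /eqP[] /ord_inj /enum_rank_inj ->.
  exact: eqxx.
Qed.

Definition chi (G : signed_graph) : nat := ex_minn (colorable_exists G).

(* Main.v *)
Require Import Defs.
From HB Require Import structures.
From mathcomp Require Import all_boot all_order all_algebra all_field.
From mathcomp Require Import all_classical all_reals all_analysis.
From mathcomp Require Import ring zify.
Set Implicit Arguments.
Unset Strict Implicit.
Unset Printing Implicit Defensive.
Import Order.TTheory GRing.Theory Num.Theory.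
Local Open Scope ring_scope.

(* Identify the colors with a field [F] of order k so that negation of colors
   becomes an affine map sigma. Then the k-colorings are the nonzeros of the
   product over the edges uv of the forms [x_v - x_u] (positive edges) and
   [x_v - sigma x_u] (negative edges), a polynomial function of degree at most m
   that does not vanish identically. Such a function of degree d in n variables
   has at least [k ^ (n - d / (k - 1))] nonzeros (a weak form of the
   Alon-Furedi theorem): by induction on n, if t is the degree in the last
   variable, then above every nonzero of the leading coefficient, which has
   degree at most d - t, lie at least [k - t] nonzeros, and
   [k - t >= k ^ (1 - t / (k - 1))] by convexity of the exponential. *)

(** * Polynomial functions of bounded degree *)

(** Functions on [F ^ V], not formal polynomials: only variables listed in [s] occur, and [d] is
    merely an upper bound on the degree. *)
Inductive degree_le (V : finType) (F : finFieldType) (s : seq V) :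
    nat -> ({ffun V -> F} -> F) -> Prop :=
| DegreeConst d c : degree_le s d (fun=> c)
| DegreeAdd d f g :
    degree_le s d f -> degree_le s d g -> degree_le s d (fun x => f x + g x)
| DegreeVar d v f :
    v \in s -> degree_le s d f -> degree_le s d.+1 (fun x => x v * f x).

Lemma eq_degree_le (V : finType) (F : finFieldType) (s : seq V) d
    (f g : {ffun V -> F} -> F) :
  f =1 g -> degree_le s d f -> degree_le s d g.
Proof. by move=> /funext ->. Qed.

Lemma degree_leS (V : finType) (F : finFieldType) (s : seq V) d
    (f : {ffun V -> F} -> F) :
  degree_le s d f -> degree_le s d.+1 f.
Proof.
by elim=> *; [exact: DegreeConst | exact: DegreeAdd | exact: DegreeVar].
Qed.

Lemma degree_leW (V : finType) (F : finFieldType) (s : seq V) d d'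
    (f : {ffun V -> F} -> F) :
  (d <= d')%N -> degree_le s d f -> degree_le s d' f.
Proof.
move=> /subnK <-; elim: (d' - d)%N => // e IHe df; rewrite addSn.
exact/degree_leS/IHe.
Qed.

Lemma degree_leZ (V : finType) (F : finFieldType) (s : seq V) d c
    (f : {ffun V -> F} -> F) :
  degree_le s d f -> degree_le s d (fun x => c * f x).
Proof.
elim=> {d f} [d b | d f g _ dcf _ dcg | d v f vs _ dcf].
- exact: DegreeConst.
- apply: eq_degree_le (DegreeAdd dcf dcg) => x; by rewrite mulrDr.
- apply: eq_degree_le (DegreeVar vs dcf) => x; by rewrite mulrCA.
Qed.

Lemma degree_le_affine_mul (V : finType) (F : finFieldType) (s : seq V) d u v
    (a b : F) (f : {ffun V -> F} -> F) :
  u \in s -> v \in s -> degree_le s d f ->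
  degree_le s d.+1 (fun x => (x v - (a * x u + b)) * f x).
Proof.
move=> us vs df.
apply: (@eq_degree_le _ _ _ _
  (fun x => x v * f x + (- a * (x u * f x) + - b * f x))).
  by move=> x; ring.
by do ![apply: DegreeAdd | apply: degree_leZ | apply: DegreeVar
       | apply: degree_leS].
Qed.

Definition set_coord (V : finType) (F : Type) (x : {ffun V -> F}) v c :
    {ffun V -> F} :=
  [ffun w => if w == v then c else x w].

Lemma degree_le_indep (V : finType) (F : finFieldType) (s : seq V) d v
    (f : {ffun V -> F} -> F) x c :
  v \notin s -> degree_le s d f -> f (set_coord x v c) = f x.
Proof.
move=> vs; elim=> {d f} [//| d f g _ -> _ -> // | d w f ws _ ->].
by rewrite ffunE; case: eqVneq ws vs => // -> ->.
Qed.

(* [h] may serve as the coefficient of [x_v ^+ j] in a function of degree [d]. *)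
Definition coef_degree (V : finType) (F : finFieldType) (s : seq V) (d j : nat)
    (h : {ffun V -> F} -> F) : Prop :=
  h = (fun=> 0) \/ (j <= d)%N /\ degree_le s (d - j) h.

Lemma coef_degreeD (V : finType) (F : finFieldType) (s : seq V) d j
    (g h : {ffun V -> F} -> F) :
  coef_degree s d j g -> coef_degree s d j h ->
  coef_degree s d j (fun x => g x + h x).
Proof.
move=> [->|[jd dg]] [->|[jd' dh]].
- by left; apply: funext => x; rewrite addr0.
- by right; split=> //; apply: eq_degree_le dh => x; rewrite add0r.
- by right; split=> //; apply: eq_degree_le dg => x; rewrite addr0.
- by right; split=> //; exact: DegreeAdd.
Qed.

(* Degrees in [v] are kept below [#|F|] by rewriting [x_v ^+ #|F|] as [x_v]. *)
Lemma degree_le_split (V : finType) (F : finFieldType) (s : seq V) d v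
    (f : {ffun V -> F} -> F) :
  degree_le (v :: s) d f ->
  exists2 g : nat -> {ffun V -> F} -> F,
    forall j, coef_degree s d j (g j) &
    forall x, f x = \sum_(j < #|F|) g j x * x v ^+ j.
Proof.
have := finNzRing_gt1 F; case cF: #|F| => [//|[//|q]] _.
elim=> {d f} [d c | d f1 f2 _ [g1 dg1 Eg1] _ [g2 dg2 Eg2] | d w f ws _ [g dg Eg]].
- exists (fun j _ => if j is 0%N then c else 0) => [[|j]|x].
  + by right; split=> //; exact: DegreeConst.
  + by left.
  + rewrite big_ord_recl /= expr0 mulr1 big1 ?addr0 // => i _.
    by rewrite /bump add1n mul0r.
- exists (fun j x => g1 j x + g2 j x) => [j|x]; first exact: coef_degreeD.
  by rewrite Eg1 Eg2 -big_split; apply: eq_bigr => i _; rewrite mulrDl.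
have [<-{ws}|wv] := eqVneq v w.
  (* Multiplying by [x v] shifts every coefficient up by one. As [#|F| = q.+2], the top term becomes
     a multiple of [x v ^+ #|F| = x v], so [g q.+1] wraps around to index 1. *)
  exists (fun j x => if j is i.+1 then
            g i x + (if i is 0%N then g q.+1 x else 0) else 0) => [[|j]|x].
  - by left.
  - apply: coef_degreeD.
      by have [->|[jd dgj]] := dg j; [left | right; rewrite ltnS subSS].
    case: j => [|j]; last by left.
    have [->|[qd dgq]] := dg q.+1; [by left | right; split=> //].
    by apply: degree_leW dgq; lia.
  - rewrite Eg big_ord_recr [RHS]big_ord_recl /= mul0r add0r mulrDr.
    rewrite mulrCA -exprS -cF expf_card.
    under [RHS]eq_bigr do rewrite /bump add1n.
    rewrite [in LHS]big_ord_recl [in RHS]big_ord_recl /= expr0 mulr1 expr1.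
    rewrite mulrDr mulrDl [x v * _]mulrC mulr_sumr -!addrA; congr (_ + _).
    rewrite addrC; congr (_ + _); apply: eq_bigr => i _.
    by rewrite /bump !add1n addr0 [in RHS]exprS; ring.
exists (fun j (x : {ffun V -> F}) => x w * g j x) => [j|x].
  have [->|[jd dgj]] := dg j; first by left; apply: funext => x; rewrite mulr0.
  right; split; first exact: leqW.
  rewrite subSn //; apply: DegreeVar => //.
  by move: ws; rewrite inE eq_sym (negPf wv).
by rewrite Eg mulr_sumr; apply: eq_bigr => j _; rewrite mulrA.
Qed.

(** * Counting nonzeros *)

(** For [l = 1 - t / (q - 1)] in [0, 1], the chord of exp from 0 to [ln q] gives
    [q ^ l <= l * q + (1 - l) = q - t]. *)
Lemma powR_le_sub (R : realType) (q t : nat) :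
  (1 < q)%N -> (t < q)%N ->
  q%:R `^ (1 - t%:R / (q%:R - 1)) <= (q - t)%:R :> R.
Proof.
move=> q1 tq.
have q0 : q%:R != 0 :> R by rewrite pnatr_eq0; lia.
have q10 : 0 < q%:R - 1 :> R by rewrite subr_gt0 ltr1n.
set l := 1 - _; have l0 : 0 <= l.
  by rewrite subr_ge0 ler_pdivrMr // mul1r lerBrDr natr1 ler_nat.
have l1 : l <= 1 by rewrite gerBl divr_ge0 // ltW.
have := convex_expR (Itv01 l0 l1) (ln q%:R) 0.
rewrite !convRE /= mulr0 addr0 expR0 lnK ?posrE ?ltr0n; last by lia.
rewrite /powR (negPf q0) mulr1 => /le_trans -> //.
rewrite /unstable.onem natrB 1?ltnW // le_eqVlt; apply/orP; left; apply/eqP.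
by rewrite /l; field; rewrite gt_eqF.
Qed.

(** Double counting of the pairs [(x, c)] with [P (set_coord x v c)]. Exchanging [c] with the
    coordinate [x v] is an involution on pairs, so each point of [P] is hit [#|F|] times. *)
Lemma card_fiberwise_ge (V F : finType) (P Q : pred {ffun V -> F}) v b :
  (forall x, Q x -> (b <= #|[pred c | P (set_coord x v c)]|)%N) ->
  (b * #|Q| <= #|F| * #|P|)%N.
Proof.
move=> hb.
have <- : (\sum_x \sum_c P (set_coord x v c) = #|F| * #|P|)%N.
  rewrite pair_big /=.
  pose h (y : {ffun V -> F} * F) := (set_coord y.1 v y.2, y.1 v).
  have hK : involutive h.
    case=> x c; rewrite /h /= ffunE eqxx; congr (_, _).
    by apply/ffunP => w; rewrite !ffunE; case: eqP => [->|].
  rewrite (reindex_inj (inv_inj hK)) /=.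
  transitivity (\sum_(y : {ffun V -> F} * F) P y.1)%N.
    apply: eq_bigr => -[x c] _; have := hK (x, c).
    by rewrite {1}/h => -[-> _].
  rewrite -(pair_big xpredT xpredT (fun x _ => P x : nat)) /=.
  under eq_bigr do rewrite sum_nat_const.
  by rewrite -big_distrr /= -(sum1_card P) [in RHS]big_mkcond.
rewrite mulnC -sum_nat_const big_mkcond; apply: leq_sum => x _.
case: ifP => // /hb /leq_trans -> //.
by rewrite -sum1_card big_mkcond.
Qed.

(** The induction is on the list [s] of variables that may occur; the space keeps all [#|V|]
    coordinates, so coefficients and [f] share one domain. *)
Lemma card_nonzeros_ge (R : realType) (V : finType) (F : finFieldType)
    (s : seq V) d (f : {ffun V -> F} -> F) (x0 : {ffun V -> F}) :
  uniq s -> degree_le s d f -> f x0 != 0 ->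
  #|F|%:R `^ (#|V|%:R - d%:R / (#|F|%:R - 1))
    <= #|[pred x | f x != 0]|%:R :> R.
Proof.
have F1 := finNzRing_gt1 F.
have F10 : 0 < #|F|%:R - 1 :> R by rewrite subr_gt0 ltr1n.
elim: s d f x0 => [|v s IHs] d f x0.
  move=> _ df fx0.
  have -> : #|[pred x | f x != 0]| = (#|F| ^ #|V|)%N.
    rewrite -card_ffun; apply: eq_card => x; rewrite !inE.
    suff -> : f x = f x0 by [].
    elim: df {fx0} => [//|e g h _ -> _ -> //|e v g]; by rewrite in_nil.
  rewrite natrX -powR_mulrn ?ler0n //; apply: ler_powR.
    by rewrite ler1n ltnW.
  by rewrite gerBl divr_ge0 // ltW.
move=> /andP[vs us] df fx0.
have [g dg Eg] := degree_le_split df.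
pose nz j := (j < #|F|)%N && [exists x, g j x != 0].
have exnz : exists j, nz j.
  apply: contrapT => /forallNP nonz; move: fx0; rewrite Eg big1 ?eqxx // => j _.
  move/negP: (nonz j); rewrite /nz ltn_ord /= negb_exists => /forallP/(_ x0).
  by rewrite negbK => /eqP ->; rewrite mul0r.
have ubnz j : nz j -> (j <= #|F|)%N by case/andP => /ltnW.
case: (ex_maxnP exnz ubnz) => t /andP[tF /existsP[y gty]] tmax.
have [gt0|[td dgt]] := dg t; first by rewrite gt0 eqxx in gty.
have/le_trans Hle := IHs _ _ _ us dgt gty.
(* On the line through [x] in direction [v], [f] is a polynomial of degree exactly [t], hence has at
   most [t] roots. *)
have fib x : g t x != 0 ->
    (#|F| - t <= #|[pred c | f (set_coord x v c) != 0%R]|)%N.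
  move=> gtx; pose P := \poly_(j < #|F|) g j x.
  have EP c : f (set_coord x v c) = P.[c].
    rewrite Eg horner_poly; apply: eq_bigr => j _; rewrite ffunE eqxx.
    have [->//|[_ dgj]] := dg j; by rewrite (degree_le_indep _ _ vs dgj).
  have P0 : P != 0.
    apply: contra gtx => /eqP/(congr1 (coefp t)).
    by rewrite /= coef_poly tF coef0 => ->.
  have sP : (size P <= t.+1)%N.
    apply/leq_sizeP => j tj; rewrite coef_poly; case: ifP => // jF.
    apply: contraTeq tj => gj; rewrite -leqNgt tmax // /nz jF.
    by apply/existsP; exists x.
  rewrite leq_subLR -(cardC [pred c | root P c]) leq_add //.
    rewrite -ltnS (leq_trans _ sP) // cardE max_poly_roots ?enum_uniq //.
    by apply/allP => c; rewrite mem_enum.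
  by apply: subset_leq_card; apply/fintype.subsetP => c; rewrite !inE EP.
have := @card_fiberwise_ge V F [pred x | f x != 0] [pred x | g t x != 0] v _ fib.
rewrite -(ler_nat R) !natrM => fibR.
have F0 : 0 < #|F|%:R :> R by rewrite ltr0n ltnW.
rewrite -(ler_pM2l F0); apply: le_trans fibR.
(* The first summand is for the fibers, the second for the leading coefficient; the final -1 cancels
   the factor [#|F|] of the double count. *)
have -> : #|V|%:R - d%:R / (#|F|%:R - 1) =
    (1 - t%:R / (#|F|%:R - 1)) + (#|V|%:R - (d - t)%:R / (#|F|%:R - 1)) - 1 :> R.
  by rewrite natrB //; field; rewrite gt_eqF.
have Fn0 : #|F|%:R != 0 :> R by rewrite gt_eqF.
rewrite powRB ?Fn0 ?implybT // powRr1 ?ler0n // mulrC divfK //.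
rewrite powRD ?Fn0 ?implybT //; apply: ler_pM; rewrite ?powR_ge0 //.
  exact: powR_le_sub.
exact: Hle.
Qed.

Lemma degree_le_prod_affine (V I : finType) (F : finFieldType)
    (u v : I -> V) (a b : I -> F) (r : seq I) :
  degree_le (enum V) (size r)
    (fun x => \prod_(i <- r) (x (v i) - (a i * x (u i) + b i))).
Proof.
elim: r => [|i r IHr] /=.
  by apply: eq_degree_le (DegreeConst _ _ 1) => x; rewrite big_nil.
apply: (@eq_degree_le _ _ _ _ (fun x => (x (v i) - (a i * x (u i) + b i)) *
  \prod_(j <- r) (x (v j) - (a j * x (u j) + b j)))) => [x|].
  by rewrite big_cons.
by apply: degree_le_affine_mul => //; rewrite mem_enum.
Qed.

(** * Colors as field elements *)

(** Greedy choice: while the chosen orbits do not cover all moved points, any uncovered one starts a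
    new orbit of size 2. The representatives will serve as positive colors, their images as negative
    ones. *)
Lemma involution_orbit_reps (T : finType) (sigma : T -> T) t :
  involutive sigma -> (t.*2 <= #|[pred x | sigma x != x]|)%N ->
  exists2 s, size s = t & uniq (s ++ map sigma s).
Proof.
move=> sK; elim: t => [_|t IHt ht]; first by exists [::].
have [|s ss us] := IHt; first by apply: leq_trans ht; rewrite leq_double.
have [/subset_leq_card/leq_trans/(_ (card_size _))|] :=
    boolP ([pred x | sigma x != x] \subset s ++ map sigma s).
  rewrite size_cat size_map ss addnn => /(leq_trans ht).
  by rewrite leq_double ltnn.
case/subsetPn => x; rewrite inE mem_cat => sx /norP[xs xms].
have sxs : sigma x \notin s.
  by apply: contra xms => /(map_f sigma); rewrite sK.
exists (x :: s); rewrite /= ?ss // mem_cat inE !negb_or xs eq_sym sx xms /=.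
move: us; rewrite !cat_uniq /= => /and3P[-> h ->].
by rewrite (negPf sxs) (negPf h) (mem_map (inv_inj sK)) xs.
Qed.

Lemma color_negation (k : nat) (c : color k) :
  exists c' : color k, val c' = - val c.
Proof.
have h : - val c \in M k by rewrite mem_M abszN oppr_eq0 -mem_M; exact: valP.
by exists (SeqSub h).
Qed.

(* In odd characteristic negation of colors becomes negation in [F]; in
   characteristic 2, where negation is trivial in [F] but has no fixed point on
   colors, it becomes translation by 1. *)
Lemma color_field_embedding (F : finFieldType) (p r k : nat) :
  p \in [pchar F] -> #|F| = k -> (0 < r)%N -> k = (p ^ r)%N ->
  exists a b : F, exists2 phi : color k -> F, injective phi &
    forall c c' : color k, val c' = - val c -> phi c' = a * phi c + b.
Proof.
move=> pF cF r0 kE; have p_pr := pcharf_prime pF.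
(* To model negation, [sigma] must move enough points to house all nonzero colors, and fix 0
   whenever 0 is a color. *)
have [a [b [sK ht h0]]] : exists a b : F,
    let sigma x := a * x + b in
    [/\ involutive sigma, (k./2.*2 <= #|[pred x | sigma x != x]|)%N
      & odd k -> sigma 0 = 0].
  have ok : odd k = odd p by rewrite kE oddX eqn0Ngt r0.
  case op : (odd p).
  - exists (-1), 0; split=> [x||_]; rewrite ?mulr0 ?addr0 //.
      by rewrite ?addr0 !mulN1r opprK.
    have -> : #|[pred x : F | -1 * x + 0 != x]| = #|predC1 (0 : F)|.
      apply: eq_card => x; rewrite !inE addr0 mulN1r; congr (~~ _).
      rewrite eq_sym -subr_eq0 opprK -mulr2n -mulr_natl mulf_eq0.
      rewrite -(dvdn_pcharf pF) orb_idl // => /dvdn_leq.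
      by case: p p_pr op {pF ok kE} => [|[|[|p]]] //= _ _ /(_ isT).
    rewrite cardC1 cF -[in leqRHS](odd_double_half k) ok op //.
  - exists 1, 1; have p2 : p = 2 by case: (even_prime p_pr); rewrite ?op.
    rewrite p2 in pF; split=> [x||]; rewrite ?ok ?op //.
      by rewrite !mul1r -addrA addrr_pchar2 ?addr0.
    have -> : #|[pred x : F | 1 * x + 1 != x]| = #|F|.
      apply: eq_card => x; rewrite !inE mul1r -[X in _ != X]addr0.
      by rewrite (inj_eq (addrI x)) oner_eq0.
    by rewrite cF -[in leqRHS](odd_double_half k) leq_addl.
pose sigma x := a * x + b; rewrite -/sigma in sK ht h0.
have {}sK : involutive sigma := sK.
have [s ss us] := involution_orbit_reps sK ht.
(* [Negz n] is [-(n+1)], so the colors of absolute value n+1 share the orbit of entry [n] of [s]. *)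
pose phi (c : int) := match c with
  | Posz 0 => 0 | Posz n.+1 => s`_n | Negz n => sigma s`_n end.
have sz c : c \in M k -> (`|c| <= size s)%N by rewrite mem_M ss => /andP[].
have mem_s n : (n < size s)%N -> s`_n \in s by exact: mem_nth.
move: us; rewrite cat_uniq (map_inj_uniq (inv_inj sK)) => /and3P[us ds _].
have s_neq i j : (i < size s)%N -> (j < size s)%N -> sigma s`_i <> s`_j.
  move=> li lj e; move/hasPn: ds => /(_ (sigma s`_i)).
  by rewrite map_f ?mem_s // => /(_ isT); rewrite /= e mem_s.
(* If 0 is a color, [k] is odd and [sigma] fixes 0, whereas it moves every entry of [s]. *)
have s0 i : (0 : int) \in M k -> (i < size s)%N -> s`_i <> 0.
  rewrite mem_M => /andP[_]; rewrite eqxx orbF => /h0 s00 li e.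
  by apply: (s_neq i i li li); rewrite e.
have ss0 i : (0 : int) \in M k -> (i < size s)%N -> sigma s`_i <> 0.
  move=> M0 li e; apply: (s0 i M0 li); rewrite -(sK s`_i) -/sigma e.
  by move: M0; rewrite mem_M eqxx orbF => /andP[_ /h0].
have s_inj i j : (i < size s)%N -> (j < size s)%N -> s`_i = s`_j -> i = j.
  by move=> li lj /eqP; rewrite nth_uniq // => /eqP.
exists a, b, (fun c => phi (val c)).
  have phi_inj : {in M k &, injective phi}.
    move=> [[|i]|i] [[|j]|j] Mi Mj /=;
      have := sz _ Mi; have := sz _ Mj => //= lj li.
    - by move/esym/s0 => [].
    - by move/esym/ss0 => [].
    - by move/s0 => [].
    - by move/s_inj => ->.
    - by move/esym/s_neq => [].
    - by move/ss0 => [].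
    - by move/s_neq => [].
    - by move/(inv_inj sK)/s_inj => ->.
  by move=> c c' /phi_inj e; apply/val_inj/e; exact: valP.
move=> c c' ->; rewrite -/(sigma _).
have := valP c; case: (val c) => [[|i]|i] //=.
by rewrite mem_M eqxx orbF => /andP[_ /h0].
Qed.

(** * Colorability and oriented edges *)

(* Passing from odd to even [k], the color 0 is lost and a new pair of colors of
   absolute value [k.+1./2] appears; vertices of color 0 are pairwise
   nonadjacent, so all of them may take the new positive color. *)
Lemma colorableS (G : signed_graph) k : colorable G k -> colorable G k.+1.
Proof.
case/existsP => f /forallP fG.
pose t := k.+1./2.
pose h (c : int) : int := if (c == 0) && odd k then t%:Z else c.
have hM (c : color k) : h (val c) \in M k.+1.
  have := valP c; rewrite /h !mem_M /t /=; case: eqVneq => [->|c0] /=.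
    by rewrite orbF => ok; rewrite ok absz_nat leqnn uphalf_half ok.
  lia.
apply/existsP; exists [ffun v => SeqSub (hM (f v))].
apply/forallP => e; apply/forallP => u; apply/forallP => v; apply/implyP => Ee.
have /forallP/(_ u)/forallP/(_ v)/implyP/(_ Ee) := fG e.
rewrite !ffunE /= /h; have /= := valP (f u); have /= := valP (f v).
move: (ssval (f u)) (ssval (f v)) => x y.
rewrite !mem_M /t; have := sgnP e; rewrite !inE.
have -> : k.+1./2 = (odd k + k./2)%N by rewrite -uphalf_half.
case: (odd k) => /=; rewrite ?andbF ?andbT.
  case: (eqVneq x 0) => [->|x0]; case: (eqVneq y 0) => [->|y0];
  by case/orP => /eqP -> /=; rewrite ?mulN1r ?mul1r ?oppr0; lia.
by [].
Qed.

Lemma colorable_chi_le (G : signed_graph) k : (chi G <= k)%N -> colorable G k.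
Proof.
rewrite /chi; case: ex_minnP => j cj _ /subnK <-.
by elim: (k - j)%N => // i IHi; rewrite addSn; exact: colorableS.
Qed.

Lemma edge_endpoints (G : graph) :
  exists uv : edge G -> vertex G * vertex G,
    forall e, ends e = [set (uv e).1; (uv e).2].
Proof.
apply: (fin_all_exists (P := fun e uv => ends e = [set uv.1; uv.2])) => e.
have /eqP/cards2P[u [v [_ ->]]] := card_ends e.
by exists (u, v).
Qed.

(** A sign is its own inverse, so the edge condition is symmetric and one orientation per edge
    suffices. *)
Lemma is_coloringP (G : signed_graph) k (f : {ffun vertex G -> color k})
    (uv : edge G -> vertex G * vertex G) :
  (forall e, ends e = [set (uv e).1; (uv e).2]) ->
  is_coloring f =
  [forall e, val (f (uv e).2) != sgn e * val (f (uv e).1)].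
Proof.
move=> Euv; apply/forallP/forallP => [fG e|fG e].
  have /forallP/(_ (uv e).1)/forallP/(_ (uv e).2)/implyP := fG e.
  by apply; rewrite Euv.
apply/forallP => u; apply/forallP => v; apply/implyP; rewrite Euv => /eqP E.
have := fG e.
have [] : ((uv e).1 = u /\ (uv e).2 = v) \/ ((uv e).1 = v /\ (uv e).2 = u).
  have : (uv e).1 \in [set u; v] by rewrite -E !inE eqxx.
  have : (uv e).2 \in [set u; v] by rewrite -E !inE eqxx orbT.
  have : u \in [set (uv e).1; (uv e).2] by rewrite E !inE eqxx.
  have : v \in [set (uv e).1; (uv e).2] by rewrite E !inE eqxx orbT.
  by rewrite !inE; do 4![case/orP => /eqP ?]; intuition congruence.
- by case=> -> ->.
- case=> -> ->; apply: contra => /eqP ->.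
  by have := sgnP e; rewrite !inE => /orP[]/eqP->; rewrite ?mulN1r ?opprK ?mul1r.
Qed.

(** * The lower bound on the number of colorings *)

Theorem theorem4p6 (R : realType) (G : signed_graph) (n m p r k : nat)
  (hn : #|vertex G| = n) (hm : #|edge G| = m)
  (hp : prime p) (hr : (0 < r)%N) (hk : k = (p ^ r)%N)
  (hchi : (chi G <= k)%N) (hmn : (m <= (k - 1) * n)%N) :
  (num_colorings G k)%:R >= k%:R `^ (n%:R - m%:R / (k%:R - 1)) :> R.
Proof.
have [F pF cF] := pPrimePowerField hp hr; rewrite -hk in cF.
have [a [b [phi phi_inj phiN]]] := color_field_embedding pF cF hr hk.
have [psi phiK psiK] : bijective phi.
  by apply: inj_card_bij => //; rewrite cF card_seq_sub ?uniq_M ?size_M.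
have [uv Euv] := edge_endpoints G.
pose ea (e : edge G) : F := if sgn e == 1 then 1 else a.
pose eb (e : edge G) : F := if sgn e == 1 then 0 else b.
pose P (x : {ffun vertex G -> F}) :=
  \prod_(e <- enum (edge G)) (x (uv e).2 - (ea e * x (uv e).1 + eb e)).
have Pcol (f : {ffun vertex G -> color k}) :
    (P [ffun v => phi (f v)] != 0) = is_coloring f.
  have edgeE e : (phi (f (uv e).2) == ea e * phi (f (uv e).1) + eb e) =
      (val (f (uv e).2) == sgn e * val (f (uv e).1)).
    rewrite /ea /eb; have := sgnP e; rewrite !inE => /orP[] /eqP -> /=.
      have [c cE] := color_negation (f (uv e).1).
      by rewrite mulN1r -cE -(phiN _ _ cE) (inj_eq phi_inj).
    by rewrite mul1r addr0 mul1r (inj_eq phi_inj).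
  rewrite (is_coloringP _ Euv) /P prodf_seq_neq0.
  apply/allP/forallP => [h e|h e _] /=.
    by have := h e; rewrite mem_enum !ffunE subr_eq0 edgeE; apply.
  by rewrite !ffunE subr_eq0 edgeE.
(* A coloring supplies the point where [P] does not vanish. *)
have /existsP[f0 f0P] := colorable_chi_le hchi.
have dP : degree_le (enum (vertex G)) m P.
  by rewrite -hm cardE; exact: degree_le_prod_affine.
have := @card_nonzeros_ge R _ _ _ _ _ _ (enum_uniq _) dP.
rewrite cF hn => /(_ [ffun v => phi (f0 v)]); rewrite Pcol => /(_ f0P).
move/le_trans; apply; rewrite ler_nat.
(* Pulling back along [psi] injects the nonzeros of [P] into the colorings. *)
pose pull (x : {ffun vertex G -> F}) := [ffun v => psi (x v)].
have pullK x : [ffun v => phi (pull x v)] = x.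
  by apply/ffunP => v; rewrite !ffunE psiK.
have pullI : injective pull by move=> x y e; rewrite -(pullK x) e pullK.
rewrite -(card_imset _ pullI); apply: subset_leq_card.
apply/fintype.subsetP => _ /imsetP[x xP ->].
by rewrite inE -Pcol pullK.
Qed.
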